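(* Let $\mathcal{B}=\{u_1,\dots,u_N\}$ be an orthonormal basis of $\mathbb{K}^N$, $X\neq\{0\}$ a Hilbert space over $\mathbb{K}$, and $m\in\{1,\dots,N\}$. Then, for every $f\in X^N$, $$\|T_mf\|_2\le\|u(m)\|_\infty\,\|f\|_2 .$$ Consequently, $T_m:L^2(V,X)\to L^2(V,X)$ is a continuous linear operator, and $$\|\widetilde T_m\|_{2\to2}=\max\{|u_k(m)|\mid k\in K_0^c\},\qquad \|\widetilde T_m^{-1}\|_{2\to2}=\frac{1}{\min\{|u_k(m)|\mid k\in K_0^c\}},$$ where $K_0:=\{k\in\{1,\dots,N\}\mid u_k(m)=0\}$ and $K_0^c$ is its complement in $\{1,\dots,N\}$. Furthermore, $$\frac{\widetilde T_m}{\|u(m)\|_\infty}\text{ is an isometric isomorphism}\iff\|u(m)\|_\infty=(N-d)^{-1/2},$$ where $d:=|K_0|$.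
   Context: $\mathbb{K}$ is $\mathbb{R}$ or $\mathbb{C}$, $N\ge1$, $V=\{1,\dots,N\}$. Elements of $X^N$ are viewed as functions $f:V\to X$ (signals). $L^2(V,X)$ denotes $X^N$ with norm $\|f\|_2=\left(\sum_{n=1}^N\|f(n)\|^2\right)^{1/2}$. $u_k(n)$ is the $n$-th component of $u_k$, $u(m)=(u_1(m),\dots,u_N(m))$, and $\|u(m)\|_\infty=\max_{1\le k\le N}|u_k(m)|$. Graph Fourier transform: $\hat f(k)=\sum_{n=1}^N\overline{u_k(n)}f(n)$. Translation operator: $T_m:X^N\to X^N$, $T_mf(n)=\sum_{k=1}^N u_k(n)\overline{u_k(m)}\hat f(k)$. The induced translation operator is the topological isomorphism $\widetilde T_m:X^N/\ker T_m\to\operatorname{im}T_m$, $\widetilde T_m(f+\ker T_m)=T_mf$, where $X^N/\ker T_m$ carries the quotient norm $\|f+\ker T_m\|=\inf\{\|f+z\|_2\mid z\in\ker T_m\}$ and $\operatorname{im}T_m$ carries the norm $\|\cdot\|_2$; $\|\cdot\|_{2\to2}$ denotes the operator norm with respect to these norms. *)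

(* Defs.v *)
From HB Require Import structures.
From mathcomp Require Import all_boot all_order all_algebra.
From mathcomp Require Import complex ring.
From mathcomp Require Import all_classical all_reals all_analysis.

Set Implicit Arguments.
Unset Strict Implicit.
Unset Printing Implicit Defensive.

Import Order.TTheory GRing.Theory Num.Theory.
Import numFieldNormedType.Exports.

Local Open Scope classical_set_scope.
Local Open Scope ring_scope.
Local Open Scope quotient_scope.

Variant base_field := RealField | ComplexField.

Definition scalar_field (R : realType) (b : base_field) : numFieldType :=
  match b with
  | RealField => R
  | ComplexField => R[i]
  end.

Section Scalar.
Context {R : realType} {b : base_field}.
Notation K := (scalar_field R b).

Definition conjK : K -> K :=
  match b return scalar_field R b -> scalar_field R b with
  | RealField => id
  | ComplexField => @conjc R
  end.

Definition ofR : R -> K :=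
  match b return R -> scalar_field R b with
  | RealField => id
  | ComplexField => real_complex R
  end.

(* Left inverse of [ofR]; only applied to nonnegative elements of K. *)
Definition toR : K -> R :=
  match b return scalar_field R b -> R with
  | RealField => id
  | ComplexField => @complex.Re R
  end.

Lemma conjK_is_zmod_morphism : zmod_morphism conjK.
Proof. by rewrite /conjK; case: b => // x y; rewrite rmorphB. Qed.

Lemma conjK_is_monoid_morphism : monoid_morphism conjK.
Proof.
rewrite /conjK; case: b => //; split; first exact: rmorph1.
by move=> x y; rewrite rmorphM.
Qed.

HB.instance Definition _ :=
  GRing.isZmodMorphism.Build K K conjK conjK_is_zmod_morphism.
HB.instance Definition _ :=
  GRing.isMonoidMorphism.Build K K conjK conjK_is_monoid_morphism.

Lemma ofR0 : ofR 0 = 0.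
Proof. by rewrite /ofR; case: b. Qed.

Lemma ofRD : {morph ofR : x y / x + y}.
Proof. by rewrite /ofR; case: b => // x y; rewrite rmorphD. Qed.

Lemma ofRM : {morph ofR : x y / x * y}.
Proof. by rewrite /ofR; case: b => // x y; rewrite rmorphM. Qed.

Lemma ofRK : cancel ofR toR.
Proof. by rewrite /ofR /toR; case: b. Qed.

Lemma ler_ofR : {mono ofR : x y / x <= y}.
Proof. by rewrite /ofR; case: b => // x y; exact: lecR. Qed.

Lemma toRK (x : K) : 0 <= x -> ofR (toR x) = x.
Proof.
by rewrite /ofR /toR; case: b x => //= x x0; rewrite RRe_real// ger0_real.
Qed.

(* The norm of a normed space over K is valued in K; [rnorm] is the same norm,
   as a real number. On V := K it is the modulus. *)
Definition rnorm (V : normedZmodType K) (x : V) : R := toR `|x|.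

Lemma ofR_rnorm (V : normedZmodType K) (x : V) : ofR (rnorm x) = `|x|.
Proof. exact: toRK. Qed.

Lemma rnorm_ge0 (V : normedZmodType K) (x : V) : 0 <= rnorm x.
Proof. by rewrite -ler_ofR ofR_rnorm ofR0. Qed.

Lemma rnorm_eq0 (V : normedZmodType K) (x : V) : rnorm x = 0 -> x = 0.
Proof. by move=> x0; apply/normr0_eq0; rewrite -ofR_rnorm x0 ofR0. Qed.

Lemma ler_rnormD (V : normedZmodType K) (x y : V) :
  rnorm (x + y) <= rnorm x + rnorm y.
Proof. by rewrite -ler_ofR ofRD !ofR_rnorm ler_normD. Qed.

Lemma rnormZ (V : normedModType K) (a : K) (x : V) :
  rnorm (a *: x) = rnorm a * rnorm x.
Proof. by rewrite -[LHS]ofRK -[RHS]ofRK ofRM !ofR_rnorm normrZ. Qed.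

End Scalar.

Section Minkowski.
Context {R : realType} (I : finType).
Implicit Types x y : I -> R.

Lemma cauchy_schwarz_sum x y :
  (\sum_i x i * y i) ^+ 2 <= (\sum_i x i ^+ 2) * (\sum_i y i ^+ 2).
Proof.
set A := \sum_i x i ^+ 2; set B := \sum_i y i ^+ 2; set C := \sum_i _.
have A0 : 0 <= A by apply: sumr_ge0 => i _; exact: sqr_ge0.
have H (s t : R) : 0 <= s ^+ 2 * A - (s * t * C) *+ 2 + t ^+ 2 * B.
  rewrite [X in 0 <= X](_ : _ = \sum_i (s * x i - t * y i) ^+ 2).
    by apply: sumr_ge0 => i _; exact: sqr_ge0.
  rewrite /A /B /C !mulr_sumr -sumrMnl -sumrB -big_split/=.
  by apply: eq_bigr => i _; ring.
have [A_eq0|A_neq0] := eqVneq A 0.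
  suff -> : C = 0 by rewrite A_eq0 expr0n mul0r.
  apply: big1 => i _; suff -> : x i = 0 by rewrite mul0r.
  apply/eqP; rewrite -sqrf_eq0; apply/eqP/(psumr_eq0P _ A_eq0) => // j _.
  exact: sqr_ge0.
have {}A0 : 0 < A by rewrite lt0r A_neq0.
have := H C A.
have -> : C ^+ 2 * A - (C * A * C) *+ 2 + A ^+ 2 * B = A * (A * B - C ^+ 2).
  by ring.
by rewrite pmulr_rge0// subr_ge0.
Qed.

Lemma minkowski_sum x y : (forall i, 0 <= x i) -> (forall i, 0 <= y i) ->
  Num.sqrt (\sum_i (x i + y i) ^+ 2) <=
  Num.sqrt (\sum_i x i ^+ 2) + Num.sqrt (\sum_i y i ^+ 2).
Proof.
move=> x0 y0.
have S0 z : 0 <= \sum_i z i ^+ 2 :> R.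
  by apply: sumr_ge0 => i _; exact: sqr_ge0.
rewrite -[leRHS]ger0_norm ?addr_ge0 ?sqrtr_ge0// -sqrtr_sqr ler_wsqrtr//.
rewrite sqrrD !sqr_sqrtr// (eq_bigr _ (fun i _ => sqrrD (x i) (y i))).
rewrite !big_split/= lerD2r lerD2l.
rewrite -mulr2n lerMn2r/= -sqrtrM ?S0//.
rewrite -[leLHS]ger0_norm; last by apply: sumr_ge0 => i _; exact: mulr_ge0.
by rewrite -sqrtr_sqr ler_wsqrtr// cauchy_schwarz_sum.
Qed.

End Minkowski.

Section L2.
Context {R : realType} {b : base_field}.
Notation K := (scalar_field R b).

(* An alias of the finite functions, so that the norm and the topology below are
   attached to it and to no other type. *)
Definition L2 (N : nat) (X : normedModType K) := {ffun 'I_N -> X}.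

Context {N : nat} {X : normedModType K}.
Notation E := (L2 N X).

HB.instance Definition _ := GRing.Lmodule.on E.

Definition l2norm (f : E) : R := Num.sqrt (\sum_(n < N) rnorm (f n) ^+ 2).

Lemma ler_l2normD (f g : E) : ofR (l2norm (f + g)) <=
  ofR (l2norm f) + ofR (l2norm g) :> K.
Proof.
rewrite -ofRD ler_ofR.
apply: le_trans (minkowski_sum (fun n => rnorm_ge0 (f n))
                               (fun n => rnorm_ge0 (g n))).
rewrite ler_wsqrtr// ler_sum// => n _.
by rewrite ffunE ler_pXn2r ?nnegrE ?addr_ge0 ?rnorm_ge0 ?ler_rnormD.
Qed.

Lemma l2normZ (a : K) (f : E) : ofR (l2norm (a *: f)) = `|a| * ofR (l2norm f).
Proof.
rewrite -[`|a|]ofR_rnorm -ofRM; congr ofR.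
rewrite -[rnorm a]ger0_norm ?rnorm_ge0// -sqrtr_sqr -sqrtrM ?sqr_ge0//.
rewrite mulr_sumr; congr Num.sqrt; apply: eq_bigr => n _.
by rewrite ffunE rnormZ exprMn.
Qed.

Lemma l2norm_eq0 (f : E) : ofR (l2norm f) = 0 :> K -> f = 0.
Proof.
rewrite -[RHS](@ofR0 R b) => /(can_inj ofRK)/eqP.
rewrite sqrtr_eq0 => f_le0; apply/ffunP => n; rewrite ffunE.
have s0 (i : 'I_N) : 0 <= rnorm (f i) ^+ 2 by exact: sqr_ge0.
have f_eq0 : \sum_(i < N) rnorm (f i) ^+ 2 = 0.
  by apply/eqP; rewrite eq_le f_le0 sumr_ge0.
apply: rnorm_eq0; apply/eqP; rewrite -sqrf_eq0; apply/eqP.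
exact: (psumr_eq0P (fun i _ => s0 i) f_eq0).
Qed.

HB.instance Definition _ := Lmodule_isNormed.Build K E
  ler_l2normD l2normZ l2norm_eq0.

Lemma rnormE (f : E) : rnorm f = l2norm f.
Proof. exact: ofRK. Qed.

End L2.
Arguments L2 {R b} N X.

Section InducedMap.
Context {K : numFieldType} {U V : lmodType K} (T : {linear U -> V}).

Definition ker : {pred U} := [pred f | T f == 0].

Lemma ker_submod_closed : submod_closed ker.
Proof.
split=> [|a f g]; rewrite !inE ?linear0// => /eqP Tf /eqP Tg.
by rewrite linearP Tf Tg scaler0 addr0.
Qed.
HB.instance Definition _ := GRing.isSubmodClosed.Build K U ker
  (GRing.submod_closed_semi ker_submod_closed).

Definition im : {pred V} := [pred g | `[< exists f, T f = g >]].

Lemma im_submod_closed : submod_closed im.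
Proof.
split=> [|a g h]; first by apply/asboolP; exists 0; exact: linear0.
move=> /asboolP[f <-] /asboolP[f' <-].
by apply/asboolP; exists (a *: f + f'); exact: linearP.
Qed.
HB.instance Definition _ := GRing.isSubmodClosed.Build K V im
  (GRing.submod_closed_semi im_submod_closed).

Definition quot_ker := Quotient.quot ker.
HB.instance Definition _ := GRing.Zmodule.on quot_ker.
HB.instance Definition _ := ZmodQuotient.on quot_ker.

Lemma quot_kerP (f g : U) : \pi_quot_ker f = \pi_quot_ker g <-> T f = T g.
Proof.
split=> [/eqP|Tfg]; last apply/eqP.
  by rewrite -Quotient.idealrBE inE linearB subr_eq0 => /eqP.
by rewrite -Quotient.idealrBE inE linearB Tfg subrr.
Qed.

Definition quot_scale (a : K) (q : quot_ker) : quot_ker :=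
  \pi_quot_ker (a *: repr q).

Lemma quot_scale_pi a f : quot_scale a (\pi_quot_ker f) = \pi_quot_ker (a *: f).
Proof.
apply/quot_kerP; rewrite !linearZ; congr (_ *: _).
by apply/quot_kerP; rewrite reprK.
Qed.

Lemma pi_quotD (f g : U) : \pi_quot_ker (f + g) = \pi_quot_ker f + \pi_quot_ker g.
Proof. by rewrite [RHS]piE. Qed.

Let scalerA_quot a c q : quot_scale a (quot_scale c q) = quot_scale (a * c) q.
Proof. by rewrite [LHS]quot_scale_pi scalerA. Qed.
Let scale1r_quot : left_id 1 quot_scale.
Proof. by move=> q; rewrite /quot_scale scale1r reprK. Qed.
Let scalerDr_quot : right_distributive quot_scale +%R.
Proof.
move=> a q r; rewrite -{1}[q]reprK -{1}[r]reprK.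
by rewrite -pi_quotD quot_scale_pi scalerDr pi_quotD.
Qed.
Let scalerDl_quot q : {morph quot_scale^~ q : a c / a + c}.
Proof. by move=> a c; rewrite /quot_scale scalerDl pi_quotD. Qed.

HB.instance Definition _ := GRing.Zmodule_isLmodule.Build K quot_ker
  scalerA_quot scale1r_quot scalerDr_quot scalerDl_quot.

Record im_type := ImElt { im_val : V; im_valP : im_val \in im }.
HB.instance Definition _ := [isSub for im_val].
HB.instance Definition _ := [Choice of im_type by <:].
HB.instance Definition _ := [SubChoice_isSubLmodule of im_type by <:].

Lemma mem_im f : T f \in im.
Proof. by apply/asboolP; exists f. Qed.

Lemma imP (g : im_type) : exists f, T f == val g.
Proof. by have /asboolP[f <-] := valP g; exists f. Qed.

(* Defined on an arbitrary representative; [induced_map_pi] shows that the choice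
   is irrelevant. *)
Definition induced_map (q : quot_ker) : im_type := ImElt (mem_im (repr q)).

Lemma induced_map_pi f : val (induced_map (\pi_quot_ker f)) = T f.
Proof. by apply/quot_kerP; rewrite reprK. Qed.

Lemma induced_map_is_linear : linear induced_map.
Proof.
move=> a q r.
have -> : a *: q + r = \pi_quot_ker (a *: repr q + repr r).
  by rewrite pi_quotD reprK.
by apply: val_inj; rewrite induced_map_pi linearP.
Qed.
HB.instance Definition _ :=
  GRing.isLinear.Build K quot_ker im_type _ induced_map induced_map_is_linear.

Definition induced_map_inv (g : im_type) : quot_ker := \pi_quot_ker (xchoose (imP g)).

Lemma induced_map_invK : cancel induced_map_inv induced_map.
Proof.
move=> g; apply: val_inj; rewrite /induced_map_inv induced_map_pi.
exact/eqP/(xchooseP (imP g)).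
Qed.

Lemma induced_mapK : cancel induced_map induced_map_inv.
Proof.
move=> q; rewrite -[RHS]reprK; apply/quot_kerP.
exact/eqP/(xchooseP (imP _)).
Qed.

End InducedMap.
Arguments induced_map {K U V} T q.
Arguments induced_map_inv {K U V} T g.

Section Norms.
Context {R : realType} {b : base_field}.
Notation K := (scalar_field R b).

Section Induced.
Context {U V : normedModType K} (T : {linear U -> V}).

Definition quot_norm (q : quot_ker T) : R :=
  inf [set rnorm f | f in [set f | \pi_(quot_ker T) f = q]].

Lemma quot_norm_pi f :
  quot_norm (\pi_(quot_ker T) f) = inf [set rnorm (f + z) | z in [set z | T z = 0]].
Proof.
congr inf; apply/seteqP; split=> _ [g /= Hg <-].
  exists (g - f); last by rewrite addrC subrK.
  by move/quot_kerP: Hg => Tg; rewrite /= linearB Tg subrr.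
by exists (f + g) => //=; apply/quot_kerP; rewrite linearD Hg addr0.
Qed.

Definition im_norm (g : im_type T) : R := rnorm (val g).

End Induced.

(* The norms are explicit parameters: they are functions on the quotient and on
   the image, which are not declared as normed modules. *)
Definition opnorm (U V : lmodType K) (nU : U -> R) (nV : V -> R) (A : U -> V) :
    \bar R :=
  ereal_sup [set (nV (A x))%:E | x in [set x | nU x <= 1]].

Definition isometric_isomorphism (U V : lmodType K) (nU : U -> R) (nV : V -> R)
    (A : U -> V) : Prop :=
  [/\ linear A, bijective A & forall x, nV (A x) = nU x].

End Norms.
Arguments quot_norm {R b U V} T q.
Arguments im_norm {R b U V} T g.

Section Translation.
Context {R : realType} {b : base_field}.
Notation K := (scalar_field R b).

Definition orthonormal_basis (N : nat) (u : 'I_N -> 'rV[K]_N) : Prop :=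
  (forall k l, \sum_(n < N) u k 0 n * conjK (u l 0 n) = (k == l)%:R) /\
  basis_of fullv [seq u k | k : 'I_N].

Context {N : nat} {X : normedModType K} (u : 'I_N -> 'rV[K]_N).

Definition gft (f : L2 N X) : L2 N X :=
  [ffun k : 'I_N => \sum_(n < N) conjK (u k 0 n) *: f n].

Definition translation (m : 'I_N) (f : L2 N X) : L2 N X :=
  [ffun n : 'I_N => \sum_(k < N) (u k 0 n * conjK (u k 0 m)) *: gft f k].

Lemma gft_is_linear : linear gft.
Proof.
move=> a f g; apply/ffunP => k; rewrite !ffunE scaler_sumr -big_split/=.
by apply: eq_bigr => n _; rewrite !ffunE scalerDr !scalerA mulrC.
Qed.

Lemma translation_is_linear m : linear (translation m).
Proof.
move=> a f g; apply/ffunP => n; rewrite !ffunE scaler_sumr -big_split/=.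
apply: eq_bigr => k _.
by rewrite gft_is_linear !ffunE scalerDr !scalerA [_ * a]mulrC.
Qed.
HB.instance Definition _ m := GRing.isLinear.Build K (L2 N X) (L2 N X) _
  (translation m) (translation_is_linear m).

End Translation.
Arguments translation {R b N X} u m f.

Definition unorm {R : realType} {b : base_field} {N : nat}
    (u : 'I_N -> 'rV[scalar_field R b]_N) (m : 'I_N) : R :=
  \big[Num.max/0]_(k < N) rnorm (u k 0 m).

(* Main.v *)
Require Import Defs.
From mathcomp Require Import all_boot all_order all_algebra.
From mathcomp Require Import complex.
From mathcomp Require Import all_classical all_reals all_analysis.

Set Implicit Arguments.
Unset Strict Implicit.
Unset Printing Implicit Defensive.

Import Order.TTheory GRing.Theory Num.Theory.
Import numFieldNormedType.Exports.

Local Open Scope ring_scope.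
Local Open Scope quotient_scope.

(** The Fourier transform diagonalises the translation: the k-th coefficient of
[T_m f] is [conj (u_k(m))] times that of [f] ([gft_translation]).  Since [X] is a
Hilbert space, the transform is also isometric from [L2] to [L2] ([parseval]);
this is the only place where the inner product enters.

Consequently [ker T_m] consists of the signals whose coefficients vanish off
[K0], where [u_k(m) = 0], and the quotient norm of the class of [f] is the norm
of its orthogonal projection, which erases the coefficients in [K0]
([quot_norm2_translation]).  The squared norms of [f + ker T_m] and of [T_m f]
are thus two sums over the same indices [k] outside [K0],
  [\sum_k |f^(k)|^2]  and  [\sum_k |u_k(m)|^2 |f^(k)|^2],
so the induced map behaves like a diagonal operator with the nonzero weights
[|u_k(m)|].  Its norm is the largest weight and the norm of its inverse is the
inverse of the smallest one; both are attained on the signals [u_k(.) x], whose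
transform is concentrated at one frequency.

The rescaled map is isometric iff all the weights outside [K0] are equal to
their maximum [M].  The weights satisfy [\sum_k |u_k(m)|^2 = 1], because the
columns of a unitary matrix are unit vectors ([sum_rnorm2_column]).  As none of
the [N - d] nonzero weights exceeds [M], they are all equal to [M] iff
[(N - d) M^2 = 1] ([constant_modulusP]). *)

(** * Scalars, norms and bounded operators *)

Section Scalars.
Context {R : realType} {b : base_field}.
Notation K := (scalar_field R b).

Lemma ofR_sum (I : Type) (r : seq I) (P : pred I) (F : I -> R) :
  ofR (\sum_(i <- r | P i) F i) = \sum_(i <- r | P i) ofR (F i) :> K.
Proof. by apply: (big_morph (@ofR R b)); [exact: ofRD|exact: ofR0]. Qed.

Lemma rnorm_ofR (x : R) : rnorm (ofR x : K) = `|x|.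
Proof.
apply: (can_inj (@ofRK R b)); rewrite ofR_rnorm.
by case: b => //=; rewrite normc_def /= expr0n addr0 sqrtr_sqr.
Qed.

Lemma rnorm0 (V : normedModType K) : rnorm (0 : V) = 0.
Proof. by apply: (can_inj (@ofRK R b)); rewrite ofR_rnorm normr0 ofR0. Qed.

Lemma rnorm_gt0 (V : normedModType K) (x : V) : x != 0 -> 0 < rnorm x.
Proof.
by move=> x0; rewrite lt0r rnorm_ge0 andbT; apply: contra x0 => /eqP/rnorm_eq0 ->.
Qed.

Lemma mulr_conjK (a : K) : a * conjK a = ofR (rnorm a ^+ 2).
Proof.
rewrite ofRM ofR_rnorm -expr2.
move: a; rewrite /conjK /scalar_field; case: b => [a|a]; last by rewrite sqr_normc.
by rewrite real_normK ?num_real.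
Qed.

Lemma conjKK (a : K) : conjK (conjK a) = a.
Proof. by move: a; rewrite /conjK; case: b => //= a; rewrite conjcK. Qed.

Lemma rnorm_conjK (a : K) : rnorm (conjK a) = rnorm a.
Proof.
apply/eqP; rewrite -(@eqrXn2 _ 2) ?rnorm_ge0//; apply/eqP.
apply: (can_inj (@ofRK R b)).
by rewrite -!mulr_conjK conjKK mulrC.
Qed.

Lemma exists_rnorm (X : normedModType K) (r : R) :
  (exists x : X, x != 0) -> 0 <= r -> exists x : X, rnorm x = r.
Proof.
move=> [x x0] r0; exists (ofR (r / rnorm x) *: x).
by rewrite rnormZ rnorm_ofR ger0_norm ?divr_ge0 ?rnorm_ge0// divfK ?gt_eqF ?rnorm_gt0.
Qed.

Lemma ofR1 : ofR 1 = 1 :> K.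
Proof. by case: (b). Qed.

Lemma rnorm2_L2 (N : nat) (X : normedModType K) (f : L2 N X) :
  rnorm f ^+ 2 = \sum_n rnorm (f n) ^+ 2.
Proof.
by rewrite rnormE sqr_sqrtr// sumr_ge0// => n _; exact: sqr_ge0.
Qed.

Lemma quot_norm_ge0 (U V : normedModType K) (T : {linear U -> V})
    (q : quot_ker T) :
  0 <= quot_norm T q.
Proof.
apply: lb_le_inf; first by exists (rnorm (repr q)), (repr q); rewrite //= reprK.
by move=> _ [f _ <-]; exact: rnorm_ge0.
Qed.

Lemma im_normZofR (U V : normedModType K) (T : {linear U -> V}) (a : R)
    (g : im_type T) : 0 <= a -> im_norm T (ofR a *: g) = a * im_norm T g.
Proof. by move=> a0; rewrite /im_norm linearZ rnormZ rnorm_ofR ger0_norm. Qed.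

(** The bound suffices on the whole unit ball because [c] is nonnegative; the unit
vector [x0] shows that the supremum is reached. *)
Lemma opnorm_attained (U V : lmodType K) (nU : U -> R) (nV : V -> R)
    (A : U -> V) (c : R) (x0 : U) :
  0 <= c -> (forall x, nV (A x) <= c * nU x) -> nU x0 = 1 -> nV (A x0) = c ->
  opnorm nU nV A = c%:E.
Proof.
move=> c0 Ac x01 Ax0; apply/eqP; rewrite eq_le; apply/andP; split.
  apply: ge_ereal_sup => _ [x /= x1 <-]; rewrite lee_fin.
  by apply: le_trans (Ac x) _; rewrite ler_piMr.
by apply: ereal_sup_ubound; exists x0; rewrite /= ?x01 ?Ax0.
Qed.

Lemma rnorm_bounded_continuous (U V : normedModType K) (T : {linear U -> V})
    (c : R) : (forall f, rnorm (T f) <= c * rnorm f) -> continuous T.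
Proof.
move=> Tc; apply: bounded_linear_continuous; exists (ofR `|c|).
split; first by rewrite ger0_real// -(@ofR0 R b) ler_ofR.
move=> M cM; near=> f.
rewrite /= -ofR_rnorm; apply: le_trans (ltW cM).
rewrite ler_ofR; apply: le_trans (Tc f) _.
rewrite (@le_trans _ _ (`|c| * rnorm f))// ?ler_wpM2r ?rnorm_ge0 ?ler_norm//.
rewrite ler_piMr// -(@ler_ofR R b) ofR_rnorm ofR1.
near: f; exact: nbhs0_le.
Unshelve. all: by end_near.
Qed.

End Scalars.

(** * Fourier analysis and the norms of the induced translation *)

Section Fourier.
Context {R : realType} {b : base_field}.
Notation K := (scalar_field R b).
Context {N : nat} (u : 'I_N -> 'rV[K]_N).
Hypothesis u_orthonormal :
  forall k l, \sum_(n < N) u k 0 n * conjK (u l 0 n) = (k == l)%:R.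

(** A left inverse of a square matrix is a right inverse, so that the adjoint of
the matrix of the [u_k] inverts it on both sides. *)
Lemma column_orthonormal n n' :
  \sum_(k < N) u k 0 n * conjK (u k 0 n') = (n == n')%:R.
Proof.
pose U : 'M[K]_N := \matrix_(k, n) u k 0 n.
pose U' : 'M[K]_N := \matrix_(n, l) conjK (u l 0 n).
have UU' : U *m U' = 1%:M.
  apply/matrixP => k l; rewrite !mxE -u_orthonormal.
  by apply: eq_bigr => i _; rewrite !mxE.
have /matrixP/(_ n' n) := mulmx1C UU'; rewrite !mxE eq_sym => <-.
by apply: eq_bigr => i _; rewrite !mxE mulrC.
Qed.

Lemma sum_rnorm2_column m : \sum_(k < N) rnorm (u k 0 m) ^+ 2 = 1.
Proof.
apply: (can_inj (@ofRK R b)); rewrite ofR_sum.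
under eq_bigr do rewrite -mulr_conjK.
by rewrite column_orthonormal eqxx; case: (b).
Qed.

Context {X : normedModType K}.
Implicit Types f g : L2 N X.

Definition igft (c : L2 N X) : L2 N X :=
  [ffun n : 'I_N => \sum_(k < N) u k 0 n *: c k].

Lemma gftK : cancel (gft u) igft.
Proof.
move=> f; apply/ffunP => n; rewrite ffunE.
under eq_bigr do rewrite ffunE scaler_sumr.
rewrite exchange_big /= (bigD1 n)//= [X in _ + X]big1 => [|n' n'n].
  under eq_bigr do rewrite scalerA.
  by rewrite addr0 -scaler_suml column_orthonormal eqxx scale1r.
under eq_bigr do rewrite scalerA.
by rewrite -scaler_suml column_orthonormal eq_sym (negbTE n'n) scale0r.
Qed.

Lemma igftK : cancel igft (gft u).
Proof.
move=> c; apply/ffunP => k; rewrite ffunE.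
under eq_bigr do rewrite ffunE scaler_sumr.
rewrite exchange_big /= (bigD1 k)//= [X in _ + X]big1 => [|l lk].
  under eq_bigr do rewrite scalerA mulrC.
  by rewrite addr0 -scaler_suml u_orthonormal eqxx scale1r.
under eq_bigr do rewrite scalerA mulrC.
by rewrite -scaler_suml u_orthonormal (negbTE lk) scale0r.
Qed.

(** [translation u m f] is the signal synthesised from the coefficients
[conj (u_k(m)) f^(k)], and synthesis inverts the transform. *)
Lemma gft_translation m f k :
  gft u (translation u m f) k = conjK (u k 0 m) *: gft u f k.
Proof.
have -> : translation u m f = igft [ffun l => conjK (u l 0 m) *: gft u f l].
  apply/ffunP => n; rewrite !ffunE; apply: eq_bigr => l _.
  by rewrite !ffunE scalerA.
by rewrite igftK ffunE.
Qed.

(** The signal with the single nonzero Fourier coefficient [x], at frequency [k]. *)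
Definition mode (k : 'I_N) (x : X) : L2 N X := [ffun n => u k 0 n *: x].

Lemma gft_mode k x l : gft u (mode k x) l = if l == k then x else 0.
Proof.
rewrite ffunE; under eq_bigr do rewrite ffunE scalerA mulrC.
rewrite -scaler_suml u_orthonormal eq_sym.
by case: eqP; rewrite ?scale1r ?scale0r.
Qed.

Context (ip : {dot X for (@conjK R b)}).
Hypothesis ipE : forall x : X, `|x| ^+ 2 = ip x x.

(** Expanding the inner products of [f n = \sum_k u_k(n) c_k], the orthonormality
of the [u_k] kills the cross terms [ip (c_k) (c_l)]. *)
Lemma parseval f : rnorm f ^+ 2 = \sum_k rnorm (gft u f k) ^+ 2.
Proof.
rewrite rnorm2_L2 -{1}[f]gftK; move: (gft u f) => c.
apply: (can_inj (@ofRK R b)); rewrite !ofR_sum.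
have normE (x : X) : ofR (rnorm x ^+ 2) = ip x x.
  by rewrite expr2 ofRM ofR_rnorm -expr2 ipE.
under eq_bigr do rewrite normE ffunE linear_sumlz.
under [RHS]eq_bigr do rewrite normE.
rewrite exchange_big/=; apply: eq_bigr => k _.
under eq_bigr do rewrite linear_sumr.
rewrite exchange_big/= (bigD1 k)//= [X in _ + X]big1 => [|l lk].
  under eq_bigr do rewrite linearZl_LR linearZr_LR /= mulrA.
  by rewrite addr0 -mulr_suml u_orthonormal eqxx mul1r.
under eq_bigr do rewrite linearZl_LR linearZr_LR /= mulrA.
by rewrite -mulr_suml u_orthonormal eq_sym (negbTE lk) mul0r.
Qed.

Variable m : 'I_N.
Let T : {linear L2 N X -> L2 N X} := translation u m.

Lemma rnorm2_translation f :
  rnorm (T f) ^+ 2 = \sum_k (rnorm (u k 0 m) * rnorm (gft u f k)) ^+ 2.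
Proof.
rewrite parseval; apply: eq_bigr => k _.
by rewrite gft_translation rnormZ rnorm_conjK.
Qed.

Lemma translation_eqP f g :
  T f = T g <-> forall k, u k 0 m != 0 -> gft u f k = gft u g k.
Proof.
split=> [Tfg k ukm|fg].
  have /ffunP/(_ k) := congr1 (gft u) Tfg.
  rewrite !gft_translation => /scalerI; apply.
  by rewrite fmorph_eq0.
rewrite -[LHS]gftK -[RHS]gftK; congr igft; apply/ffunP => k.
rewrite !gft_translation; have [->|/fg ->//] := eqVneq (u k 0 m) 0.
by rewrite rmorph0 !scale0r.
Qed.

(** The infimum is reached at the projection [f0] of [f], which has the
coefficients of [f] outside [K0] and none inside: every other representative
agrees with [f] outside [K0], hence has a larger norm by Parseval. *)
Lemma quot_norm2_translation f :
  quot_norm T (\pi_(quot_ker T) f) ^+ 2 =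
  \sum_(k | u k 0 m != 0) rnorm (gft u f k) ^+ 2.
Proof.
pose f0 : L2 N X := igft [ffun k => if u k 0 m != 0 then gft u f k else 0].
have f0E : rnorm f0 ^+ 2 = \sum_(k | u k 0 m != 0) rnorm (gft u f k) ^+ 2.
  rewrite parseval igftK [RHS]big_mkcond; apply: eq_bigr => k _.
  by rewrite ffunE; case: ifP => // _; rewrite rnorm0 expr0n.
rewrite -f0E; congr (_ ^+ 2); apply/eqP; rewrite eq_le; apply/andP; split.
  apply: ge_inf; first by exists 0 => _ [g _ <-]; exact: rnorm_ge0.
  exists f0 => //=; apply/quot_kerP/translation_eqP => k ukm.
  by rewrite igftK ffunE ukm.
apply: lb_le_inf; first by exists (rnorm f), f.
move=> _ [g /= /quot_kerP/translation_eqP gf <-].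
rewrite -ler_sqr ?nnegrE ?rnorm_ge0// f0E parseval.
rewrite [leRHS](bigID (fun k => u k 0 m != 0))/= ler_wpDr//.
  by apply: sumr_ge0 => k _; exact: sqr_ge0.
by apply: ler_sum => k /gf ->.
Qed.

Lemma im_norm2_induced f :
  im_norm T (induced_map T (\pi_(quot_ker T) f)) ^+ 2 =
  \sum_(k | u k 0 m != 0) (rnorm (u k 0 m) * rnorm (gft u f k)) ^+ 2.
Proof.
rewrite /im_norm induced_map_pi rnorm2_translation.
rewrite (bigID (fun k => u k 0 m != 0))/= [X in _ + X]big1 ?addr0// => k.
by rewrite negbK => /eqP ->; rewrite rnorm0 mul0r expr0n.
Qed.

Lemma quot_norm_mode k x : u k 0 m != 0 ->
  quot_norm T (\pi_(quot_ker T) (mode k x)) = rnorm x.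
Proof.
move=> ukm; apply/eqP; rewrite -(@eqrXn2 _ 2) ?rnorm_ge0 ?quot_norm_ge0//.
rewrite quot_norm2_translation (bigD1 k)//= big1 => [|l /andP[_ /negbTE lk]].
  by rewrite addr0 gft_mode eqxx.
by rewrite gft_mode lk rnorm0 expr0n.
Qed.

Lemma im_norm_induced_mode k x : u k 0 m != 0 ->
  im_norm T (induced_map T (\pi_(quot_ker T) (mode k x))) =
  rnorm (u k 0 m) * rnorm x.
Proof.
move=> ukm; apply/eqP; rewrite -(@eqrXn2 _ 2) ?mulr_ge0 ?rnorm_ge0//.
rewrite im_norm2_induced (bigD1 k)//= big1 => [|l /andP[_ /negbTE lk]].
  by rewrite addr0 gft_mode eqxx.
by rewrite gft_mode lk rnorm0 mulr0 expr0n.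
Qed.

Lemma im_norm_induced_le (c : R) (q : quot_ker T) : 0 <= c ->
  (forall k, u k 0 m != 0 -> rnorm (u k 0 m) <= c) ->
  im_norm T (induced_map T q) <= c * quot_norm T q.
Proof.
move=> c0 uc; rewrite -[q]reprK.
rewrite -ler_sqr ?nnegrE ?rnorm_ge0 ?mulr_ge0 ?quot_norm_ge0//.
rewrite exprMn im_norm2_induced quot_norm2_translation mulr_sumr.
apply: ler_sum => k /uc ukc; rewrite exprMn ler_wpM2r ?sqr_ge0//.
by rewrite ler_sqr ?nnegrE ?rnorm_ge0.
Qed.

Lemma im_norm_induced_ge (c : R) (q : quot_ker T) : 0 <= c ->
  (forall k, u k 0 m != 0 -> c <= rnorm (u k 0 m)) ->
  c * quot_norm T q <= im_norm T (induced_map T q).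
Proof.
move=> c0 cu; rewrite -[q]reprK.
rewrite -ler_sqr ?nnegrE ?rnorm_ge0 ?mulr_ge0 ?quot_norm_ge0//.
rewrite exprMn im_norm2_induced quot_norm2_translation mulr_sumr.
apply: ler_sum => k /cu cuk; rewrite exprMn ler_wpM2r ?sqr_ge0//.
by rewrite ler_sqr ?nnegrE ?rnorm_ge0.
Qed.
End Fourier.

(** * When all the nonzero weights are equal *)

Section Weights.
Context {R : realType} {b : base_field} {N : nat}.
Notation K := (scalar_field R b).
Variables (u : 'I_N -> 'rV[K]_N) (m : 'I_N).
Hypothesis u_orthonormal :
  forall k l, \sum_(n < N) u k 0 n * conjK (u l 0 n) = (k == l)%:R.

Lemma rnorm_le_unorm k : rnorm (u k 0 m) <= unorm u m.
Proof. exact: (le_bigmax _ (fun k => rnorm (u k 0 m))). Qed.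

Lemma exists_nonvanishing : exists k, u k 0 m != 0.
Proof.
apply/existsP; apply: contraT; rewrite negb_exists => /forallP u0.
have := sum_rnorm2_column u_orthonormal m; rewrite big1 => [/eqP|k _].
  by rewrite eq_sym oner_eq0.
by have := u0 k; rewrite negbK => /eqP ->; rewrite rnorm0 expr0n.
Qed.

Lemma unorm_gt0 : 0 < unorm u m.
Proof.
have [k uk0] := exists_nonvanishing; apply: lt_le_trans (rnorm_le_unorm k).
exact: rnorm_gt0.
Qed.

Let K0 : {set 'I_N} := [set k | u k 0 m == 0].

Lemma card_nonvanishing : (#|~: K0|%:R : R) = N%:R - #|K0|%:R.
Proof. by rewrite -[X in X%:R - _](card_ord N) -(cardsC K0) natrD addrC addKr. Qed.

(** The squared weights outside [K0] sum to [1] and none exceeds the square of the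
maximum [M].  The sum of the nonnegative defects, [(N - d) M^2 - 1], vanishes iff
each of them does. *)
Lemma constant_modulusP :
  (forall k, u k 0 m != 0 -> rnorm (u k 0 m) = unorm u m) <->
  unorm u m = (N%:R - #|K0|%:R) `^ (- 2^-1).
Proof.
have M0 := unorm_gt0; set M := unorm u m in M0 *.
rewrite -card_nonvanishing; set r : R := _%:R.
have r0 : 0 < r.
  have [k uk0] := exists_nonvanishing.
  by rewrite ltr0n card_gt0; apply/set0Pn; exists k; rewrite !inE.
have sum1 : \sum_(k in ~: K0) rnorm (u k 0 m) ^+ 2 = 1.
  rewrite -(sum_rnorm2_column u_orthonormal m) big_mkcond.
  apply: eq_bigr => k _; rewrite !inE; case: eqP => //= ->.
  by rewrite rnorm0 expr0n.
have sumM : \sum_(k in ~: K0) M ^+ 2 = r * M ^+ 2.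
  by rewrite sumr_const mulr_natl.
have -> : (M = r `^ (- 2^-1)) <-> (r * M ^+ 2 = 1).
  rewrite powRN powR12_sqrt ?ltW//; split=> [->|rM].
    by rewrite exprVn sqr_sqrtr ?ltW// divff ?gt_eqF.
  rewrite -sqrtrV ?ltW// -[LHS]ger0_norm ?ltW// -sqrtr_sqr; congr Num.sqrt.
  by apply: (mulfI (lt0r_neq0 r0)); rewrite rM divff ?lt0r_neq0.
rewrite -sumM -sum1; split=> [uM|/eqP eqM k uk0].
  by apply: eq_bigr => k; rewrite !inE => /uM ->.
apply/eqP; rewrite -(@eqrXn2 _ 2) ?rnorm_ge0 ?(ltW M0)//.
move: eqM; rewrite -subr_eq0 -sumrB psumr_eq0 => [/allP/(_ k)|l _].
  by rewrite mem_index_enum !inE uk0 subr_eq0 eq_sym => /(_ isT).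
by rewrite subr_ge0 ler_sqr ?nnegrE ?rnorm_ge0 ?(ltW M0) ?rnorm_le_unorm.
Qed.
End Weights.

(** * The norms of the induced translation and its inverse *)

Theorem theorem5p7 (R : realType) (b : base_field) (N : nat) (hN : (1 <= N)%N)
    (u : 'I_N -> 'rV[scalar_field R b]_N) (hu : orthonormal_basis u)
    (X : completeNormedModType (scalar_field R b))
    (ip : {dot X for (@conjK R b)}) (hX : forall x : X, `|x| ^+ 2 = ip x x)
    (hX0 : exists x : X, x != 0) (m : 'I_N) :
  let T : {linear L2 N X -> L2 N X} := translation u m in
  let K0 : {set 'I_N} := [set k | u k 0 m == 0] in
  let d := #|K0| in
  [/\ forall f : L2 N X, rnorm (T f) <= unorm u m * rnorm f,
      linear T /\ continuous T,
      opnorm (quot_norm T) (im_norm T) (induced_map T) =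
        (\big[Num.max/0]_(k in ~: K0) rnorm (u k 0 m))%:E,
      (* the default value of the minimum is the largest of all the |u_k(m)|,
         hence it has no effect as K0 is a proper subset of 'I_N *)
      opnorm (im_norm T) (quot_norm T) (induced_map_inv T) =
        (1 / \big[Num.min/unorm u m]_(k in ~: K0) rnorm (u k 0 m))%:E &
      isometric_isomorphism (quot_norm T) (im_norm T)
        (fun q => ofR (unorm u m)^-1 *: induced_map T q) <->
      unorm u m = (N%:R - d%:R) `^ (- 2^-1)].
Proof.
move=> T K0 d; have [uO _] := hu.
have M0 := unorm_gt0 m uO.
have Tle f : rnorm (T f) <= unorm u m * rnorm f.
  rewrite -ler_sqr ?nnegrE ?rnorm_ge0 ?mulr_ge0 ?(ltW M0) ?rnorm_ge0//.
  rewrite (rnorm2_translation uO hX) exprMn (parseval uO hX) mulr_sumr.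
  apply: ler_sum => k _.
  rewrite exprMn ler_wpM2r ?sqr_ge0// ler_sqr ?nnegrE ?rnorm_ge0 ?(ltW M0)//.
  exact: rnorm_le_unorm.
have [j uj0] := exists_nonvanishing m uO.
have jK0 : j \in ~: K0 by rewrite !inE.
have inK0 k : (k \in ~: K0) = (u k 0 m != 0) by rewrite !inE.
split=> //.
- by split; [exact: linearP|exact: rnorm_bounded_continuous Tle].
- have [k kK0 maxE] : {k | k \in ~: K0 &
      \big[Num.max/0]_(k in ~: K0) rnorm (u k 0 m) = rnorm (u k 0 m)}.
    by apply: (eq_bigmax j) => // k _; exact: rnorm_ge0.
  rewrite maxE; move: (kK0); rewrite inK0 => uk0.
  have [x x1] := exists_rnorm hX0 ler01.
  apply: (@opnorm_attained _ _ _ _ _ _ _ _ (\pi_(quot_ker T) (mode u k x))).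
  + exact: rnorm_ge0.
  + move=> q; apply: (im_norm_induced_le uO hX); first exact: rnorm_ge0.
    by move=> l ul0; rewrite -maxE; apply: le_bigmax_cond; rewrite /= inK0.
  + by rewrite (quot_norm_mode uO hX).
  + by rewrite (im_norm_induced_mode uO hX)// x1 mulr1.
- have [k kK0 minE] : {k | k \in ~: K0 &
      \big[Num.min/unorm u m]_(k in ~: K0) rnorm (u k 0 m) = rnorm (u k 0 m)}.
    by apply: (eq_bigmin j) => // k _; exact: rnorm_le_unorm.
  rewrite minE; move: (kK0); rewrite inK0 => uk0.
  have c0 : 0 < rnorm (u k 0 m) := rnorm_gt0 uk0.
  (* With this norm, the image of the mode at [k] is a unit vector. *)
  have [x x1] : exists x : X, rnorm x = (rnorm (u k 0 m))^-1.
    by apply: exists_rnorm => //; rewrite invr_ge0 ltW.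
  rewrite div1r.
  apply: (@opnorm_attained _ _ _ _ _ _ _ _
            (induced_map T (\pi_(quot_ker T) (mode u k x)))).
  + by rewrite invr_ge0 ltW.
  + move=> g; rewrite -{2}[g](induced_map_invK (T := T)) mulrC ler_pdivlMr// mulrC.
    apply: (im_norm_induced_ge uO hX); first exact: rnorm_ge0.
    by move=> l ul0; rewrite -minE; apply: bigmin_le_cond; rewrite /= inK0.
  + by rewrite (im_norm_induced_mode uO hX)// x1 divff ?gt_eqF.
  + by rewrite induced_mapK (quot_norm_mode uO hX).
rewrite -constant_modulusP//; split=> [[_ _ iso] k uk0|uM].
  have [x x1] := exists_rnorm hX0 ler01.
  have := iso (\pi_(quot_ker T) (mode u k x)).
  rewrite im_normZofR ?invr_ge0 ?ltW// (im_norm_induced_mode uO hX)//.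
  rewrite (quot_norm_mode uO hX)//.
  by rewrite x1 mulr1 mulrC => /divr1_eq.
split=> [a q r|| q].
- by rewrite linearP scalerDr !scalerA mulrC.
- exists (fun g => induced_map_inv T (ofR (unorm u m) *: g)) => q.
    by rewrite scalerA -ofRM divff ?gt_eqF// ofR1 scale1r induced_mapK.
  by rewrite induced_map_invK scalerA -ofRM mulVf ?gt_eqF// ofR1 scale1r.
- rewrite im_normZofR ?invr_ge0 ?ltW//.
  suff -> : im_norm T (induced_map T q) = unorm u m * quot_norm T q.
    by rewrite mulrA mulVf ?gt_eqF// mul1r.
  apply: le_anti; apply/andP; split.
    by apply: (im_norm_induced_le uO hX) => [|k /uM ->//]; exact: ltW.
  by apply: (im_norm_induced_ge uO hX) => [|k /uM ->//]; exact: ltW.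
Qed.
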